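(* $m_k^*=k$ for each fixed configuration. That is, let $k$ be a positive integer and let $\mathcal{C}$ be one of the four configurations: increasing steps, decreasing steps, towers, nested rectangles. Then the least integer $m$ such that every finite family $\mathcal{F}$ of bottomless rectangles can be $k$-coloured so that any point covered by an $m$-configuration of type $\mathcal{C}$ formed by members of $\mathcal{F}$ is covered by rectangles of all $k$ colours, is $m=k$.
   Context: A (closed) bottomless rectangle is a subset of $\mathbb{R}^2$ of the form $\{(x,y): l\le x\le r,\ y\le t\}$, denoted by its parameters $(l,r,t)$; $l$ is its left-coordinate, $r$ its right-coordinate and $t$ its height. Let $R_i=(l_i,r_i,t_i)$, $i=1,\dots,m$, be bottomless rectangles with a common point and with $l_1<l_2<\dots<l_m$. They form - increasing $m$-steps if $r_1<\dots<r_m$ and $t_1<\dots<t_m$; - decreasing $m$-steps if $r_1<\dots<r_m$ and $t_1>\dots>t_m$; - an $m$-tower if $r_1>\dots>r_m$ and $t_1<\dots<t_m$; - an $m$-nested set ($m$-nested rectangles) if $r_1>\dots>r_m$ and $t_1>\dots>t_m$. A point is covered by an $m$-configuration $R_1,\dots,R_m$ if it lies in all of $R_1,\dots,R_m$. A point is covered by a colour if it lies in some rectangle of $\mathcal{F}$ of that colour. *)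

(* Defs.v *)
From mathcomp Require Import all_boot all_order all_algebra.
From mathcomp Require Import boolp classical_sets cardinality reals.

Set Implicit Arguments.
Unset Strict Implicit.
Unset Printing Implicit Defensive.

Import Order.TTheory GRing.Theory Num.Theory.

Local Open Scope classical_set_scope.
Local Open Scope ring_scope.

(* No relation between [lcoord] and [rcoord] is imposed: if [rcoord < lcoord] the
   rectangle is the empty set, and such a rectangle never occurs in a
   configuration, whose members have a common point. *)
Record brect (R : realType) := BRect {
  lcoord : R;
  rcoord : R;
  height : R
}.

Definition brect_set (R : realType) (B : brect R) : set (R * R) :=
  [set p | lcoord B <= p.1 <= rcoord B /\ p.2 <= height B].

Definition increasing (R : realType) (m : nat) (u : 'I_m -> R) : Prop :=
  forall i j : 'I_m, (i < j)%N -> u i < u j.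

Definition decreasing (R : realType) (m : nat) (u : 'I_m -> R) : Prop :=
  forall i j : 'I_m, (i < j)%N -> u j < u i.

Inductive config_type : Type :=
  | IncreasingSteps
  | DecreasingSteps
  | Tower
  | Nested.

Definition right_height_order (R : realType) (C : config_type) (m : nat)
    (B : 'I_m -> brect R) : Prop :=
  let r i := rcoord (B i) in
  let t i := height (B i) in
  match C with
  | IncreasingSteps => increasing r /\ increasing t
  | DecreasingSteps => increasing r /\ decreasing t
  | Tower => decreasing r /\ increasing t
  | Nested => decreasing r /\ decreasing t
  end.

Definition covered_by_all (R : realType) (m : nat) (B : 'I_m -> brect R)
    (p : R * R) : Prop :=
  forall i, brect_set (B i) p.

Definition configuration (R : realType) (C : config_type) (m : nat)
    (B : 'I_m -> brect R) : Prop :=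
  [/\ exists p, covered_by_all B p,
      increasing (fun i => lcoord (B i))
    & right_height_order C B].

Definition covered_by_colour (R : realType) (k : nat) (F : set (brect R))
    (c : brect R -> 'I_k) (p : R * R) (a : 'I_k) : Prop :=
  exists B, [/\ F B, c B = a & brect_set B p].

(* The values of the colouring [c] outside [F] are irrelevant. *)
Definition good_colouring (R : realType) (C : config_type) (k m : nat)
    (F : set (brect R)) (c : brect R -> 'I_k) : Prop :=
  forall (B : 'I_m -> brect R) (p : R * R),
    (forall i, F (B i)) -> configuration C B -> covered_by_all B p ->
    forall a : 'I_k, covered_by_colour F c p a.

Definition always_colourable (R : realType) (C : config_type) (k m : nat) :
    Prop :=
  forall F : set (brect R), finite_set F ->
    exists c : brect R -> 'I_k, good_colouring C m F c.

(* [is_mstar R C k m] says that m_k^* = m for the configuration type [C]. *)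
Definition is_mstar (R : realType) (C : config_type) (k m : nat) : Prop :=
  always_colourable R C k m /\
  forall n : nat, always_colourable R C k n -> (m <= n)%N.

(* Main.v *)
Require Import Defs.
From mathcomp Require Import all_boot all_order all_algebra.
From mathcomp Require Import boolp classical_sets cardinality reals.

(** A point [(x, y)] lies in the rectangle [(l, r, t)] exactly when
    [- x <= - l], [x <= r] and [y <= t], so rectangles behave as points of a
    three-dimensional space and a point of the plane selects those that
    dominate a given triple of thresholds. Any three monotone sequences, up to
    reversal of the index, contain two that are monotone in the same direction,
    and for the four configurations these two coordinates can be made strictly
    decreasing: [- l] and [r] for towers and nested rectangles, [r] and [t] for
    increasing steps read backwards, [- l] and [t] for decreasing steps. It is
    therefore enough to colour so that every chain of [k] elements, strictly
    decreasing in two coordinates and above three thresholds, sees all [k]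
    colours above these thresholds ([dominance_colouring]).

    Order the rectangles by strict dominance in the two decreasing coordinates
    and call the remaining coordinate the key. Everything that dominates a
    member of the chain meets the first two thresholds automatically, so only
    the threshold on the key matters. Colour greedily along this order, giving
    to each element the colour whose last use among its predecessors, measured
    by the key, is the oldest ([least_recent_colour]). Whatever the threshold,
    if some colour is missing among the predecessors above it, then the colour
    just given is one of the missing ones. Hence, walking along a chain, the
    number of colours seen grows by at least one at each step until it reaches
    [k] ([chain_colours]).

    Conversely, if [n < k], a family consisting of a single [n]-configuration
    has a point covered by the configuration and too few rectangles for [k]
    colours ([always_colourable_geq]). *)

Set Implicit Arguments.
Unset Strict Implicit.
Unset Printing Implicit Defensive.

Import Order.TTheory GRing.Theory Num.Theory.

(** * Greedy colourings of a finite ordered set with keys *)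

Section GreedyColouring.
Import fintype boot.finset.
Variables (disp : Order.disp_t) (K : orderType disp) (T : finType).
Variables (key : T -> K) (k : nat).

Definition seen (A : {set T}) (c : T -> 'I_k) (y : K) : {set 'I_k} :=
  [set c x | x in A & (y <= key x)%O].

Lemma mem_seen (A : {set T}) (c : T -> 'I_k) y x :
  x \in A -> (y <= key x)%O -> c x \in seen A c y.
Proof. by move=> Ax yx; apply: imset_f; rewrite inE Ax. Qed.

Lemma seenS (A B : {set T}) (c : T -> 'I_k) y :
  A \subset B -> seen A c y \subset seen B c y.
Proof.
move=> sAB; apply: imsetS; apply/subsetP=> x.
by rewrite !inE => /andP[/(subsetP sAB) -> ->].
Qed.

Lemma eq_in_seen (A : {set T}) (c c' : T -> 'I_k) y :
  {in A, c =1 c'} -> seen A c y = seen A c' y.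
Proof. by move=> cc'; apply: eq_in_imset => x; rewrite inE => /andP[/cc']. Qed.

(** The colour whose last use, in the order of increasing keys, is the oldest:
    lowering the threshold reveals the colours in the order of their last uses,
    so this one is revealed at the very end. *)
Lemma least_recent_colour (A : {set T}) (c : T -> 'I_k) : (0 < k)%N ->
  exists a, forall y, a \in seen A c y -> seen A c y = [set: 'I_k].
Proof.
move=> k_gt0; pose rank x := #|[set z | (key z <= key x)%O]|.
have rank_gt0 x : (0 < rank x)%N.
  by rewrite /rank (cardD1 x) inE lexx.
pose last_use a := (\max_(x in A | c x == a) rank x)%N.
have [a _ a_min] := @arg_minnP _ (Ordinal k_gt0) xpredT last_use isT.
exists a => y /imsetP[x]; rewrite inE => /andP[Ax yx] ac.
apply/setP=> b; rewrite in_setT; apply: contraT => b_unseen.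
have := a_min b isT; rewrite leqNgt => /negP[].
suff last_b : (last_use b < rank x)%N.
  apply: leq_trans last_b _.
  by apply: (@leq_bigmax_cond _ _ rank x); rewrite Ax ac eqxx.
(* A use of the unseen colour [b] has a key below [y], hence a smaller rank. *)
rewrite -(prednK (rank_gt0 x)) ltnS; apply/bigmax_leqP=> z /andP[Az /eqP cz].
rewrite -ltnS (prednK (rank_gt0 x)); have zy : (key z < y)%O.
  by rewrite ltNge; apply: contra b_unseen => yz; rewrite -cz mem_seen.
have zx : (key z < key x)%O by apply: lt_le_trans yx.
apply: proper_card; apply/properP; split.
  by apply/subsetP=> w; rewrite !inE => /le_trans; apply; apply: ltW.
by exists x; rewrite !inE ?lexx // -ltNge.
Qed.

Variable lt : rel T.
Hypotheses (lt_irr : irreflexive lt) (lt_trans : transitive lt).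

Definition below x : {set T} := [set z | lt z x].

(** The colour is fixed before the threshold is known, so one choice has to be
    good for all [y] simultaneously. *)
Definition greedy (c : T -> 'I_k) x :=
  forall y, c x \in seen (below x) c y -> seen (below x) c y = [set: 'I_k].

Lemma card_below z x : lt z x -> (#|below z| < #|below x|)%N.
Proof.
move=> zx; apply: proper_card; apply/properP; split.
  by apply/subsetP=> w; rewrite !inE => /lt_trans; apply.
by exists z; rewrite !inE ?lt_irr.
Qed.

(** The rule at [x] depends on the colours of the predecessors of [x] only, and
    these have strictly fewer predecessors, so the colouring is built by
    recursion on the number of predecessors. *)
Lemma exists_greedy : (0 < k)%N -> exists c, forall x, greedy c x.
Proof.
move=> k_gt0.
suff [c cP] : exists c, forall x, (#|below x| < #|T|.+1)%N -> greedy c x.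
  by exists c => x; apply: cP; rewrite ltnS max_card.
elim: #|T|.+1 => [|n [c cP]]; first by exists (fun=> Ordinal k_gt0).
have [f fP] := fin_all_exists (fun x => least_recent_colour (below x) c k_gt0).
exists (fun x => if (#|below x| < n)%N then c x else f x) => x x_n y.
rewrite (@eq_in_seen (below x) _ c); last first.
  by move=> z; rewrite inE => /card_below/leq_trans->.
by case: ifP => [/cP/(_ y)|_ /fP].
Qed.

(** Along a chain above the threshold, each step reveals a new colour: either
    the colours below the next element are already complete, or the greedy
    rule gives that element a colour missing among them. *)
Lemma chain_colours (c : T -> 'I_k) (u : 'I_k -> T) y :
    (forall x, greedy c x) ->
    (forall i j : 'I_k, (i < j)%N -> lt (u i) (u j)) ->
    (forall i, (y <= key (u i))%O) ->
  forall i : 'I_k, (i < #|seen (u i |: below (u i)) c y|)%N.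
Proof.
move=> cP ltu yu [i lt_ik] /=; elim: i lt_ik => [|i IHi] lt_ik.
  by rewrite (cardD1 (c (u (Ordinal lt_ik)))) mem_seen ?setU11.
set x := u _; set S := seen _ c y.
have le_ik := ltnW lt_ik; pose w := u (Ordinal le_ik).
have wx : lt w x by apply: ltu.
have iS : (i < #|seen (below x) c y|)%N.
  apply: leq_trans (IHi le_ik) (subset_leq_card (seenS _ _ _)).
  apply/subsetP=> z; rewrite !inE => /orP[/eqP->//|/lt_trans]; exact.
have cxS : c x |: seen (below x) c y \subset S.
  by rewrite subUset sub1set (mem_seen _ (setU11 _ _) (yu _)) seenS ?subsetUr.
have [full|new] := boolP (c x \in seen (below x) c y).
  apply: leq_trans (subset_leq_card cxS).
  by rewrite (cP x y full) setUT cardsT card_ord.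
by apply: leq_trans (subset_leq_card cxS); rewrite cardsU1 new.
Qed.

Lemma chain_all_colours (c : T -> 'I_k) (u : 'I_k -> T) y :
    (forall x, greedy c x) ->
    (forall i j : 'I_k, (i < j)%N -> lt (u i) (u j)) ->
    (forall i, (y <= key (u i))%O) ->
  forall a, exists i x, [/\ x \in u i |: below (u i), (y <= key x)%O & c x = a].
Proof.
move=> cP ltu yu a; have k_gt0 : (0 < k)%N by apply: leq_ltn_trans (ltn_ord a).
have lt_k : (k.-1 < k)%N by rewrite prednK.
pose i := Ordinal lt_k; pose S := seen (u i |: below (u i)) c y.
have S_full : S = [set: 'I_k].
  apply/eqP; rewrite eqEcard subsetT cardsT card_ord /=.
  by have := chain_colours cP ltu yu i; rewrite /= prednK.
have : a \in S by rewrite S_full inE.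
case/imsetP=> x; rewrite inE => /andP[Ax yx] ->.
by exists i, x.
Qed.

End GreedyColouring.

(** * Upper bound: chains in two of three coordinates *)

Local Open Scope classical_set_scope.
Local Open Scope ring_scope.

(** The order compares [f] and [g] only, and [h] serves as key: predecessors of
    a chain element inherit its bounds [x] and [y], and the greedy colouring
    takes care of every bound [z] at once. *)
Lemma dominance_colouring (R : realType) (T : Type) (k : nat) (F : set T)
    (f g h : T -> R) : (0 < k)%N -> finite_set F ->
  exists c : T -> 'I_k,
  forall (u : 'I_k -> T) (x y z : R), (forall i, F (u i)) ->
    decreasing (f \o u) -> decreasing (g \o u) ->
    (forall i, [/\ x <= f (u i), y <= g (u i) & z <= h (u i)]) ->
  forall a, exists B, [/\ F B, c B = a & [/\ x <= f B, y <= g B & z <= h B]].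
Proof.
(* [{classic T}] supplies the equality test that turns [F] into a finite type. *)
move=> k_gt0 /(@finite_seqP {classic T})[s Fs].
pose lt := [rel v w : seq_sub s | (f (ssval w) < f (ssval v))
                                  && (g (ssval w) < g (ssval v))].
have lt_irr : irreflexive lt by move=> v; rewrite /= ltxx.
have lt_tr : transitive lt.
  move=> v w t /= /andP[fv gv] /andP[ft gt].
  by rewrite (lt_trans ft fv) (lt_trans gt gv).
have [c cP] := exists_greedy (fun v : seq_sub s => h (ssval v))
  lt_irr lt_tr k_gt0.
exists (fun B : {classic T} =>
  if insub B is Some v then c v else Ordinal k_gt0).
move=> u x y z Fu fu gu uP a.
have su i : (u i : {classic T}) \in s by have := Fu i; rewrite Fs.
have [||i [v [vu zv <-]]] := chain_all_colours (u := fun i => SeqSub (su i))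
  (y := z) lt_tr cP _ _ a.
- by move=> i j ij; rewrite /= fu // gu.
- by move=> i; have [] := uP i.
exists (ssval v); split; first by rewrite Fs; apply: (valP v).
  by rewrite (valK v).
have [xf yg _] := uP i; move: vu; rewrite !inE.
case/orP=> [/eqP->|/andP[fv gv]]; first by split=> //; have [] := uP i.
by split; rewrite ?(le_trans xf (ltW fv)) ?(le_trans yg (ltW gv)).
Qed.

Lemma always_colourable_self (R : realType) (C : config_type) (k : nat) :
  (0 < k)%N -> always_colourable R C k k.
Proof.
move=> k_gt0 F finF.
(* Towers and nested rectangles both have nested horizontal extents; with the
   heights as keys, one colouring serves for both. *)
have nested_intervals : exists c : brect R -> 'I_k,
    forall (B : 'I_k -> brect R) p, (forall i, F (B i)) ->
      increasing (fun i => lcoord (B i)) ->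
      decreasing (fun i => rcoord (B i)) ->
      covered_by_all B p -> forall a, covered_by_colour F c p a.
  have [c cP] := dominance_colouring (fun B => - lcoord B) (@rcoord R)
    (@height R) k_gt0 finF.
  exists c => B p FB lB rB Bp a.
  have [||i|D [FD cD [lD rD hD]]] := cP B (- p.1) p.1 p.2 FB _ _ _ a.
  - by move=> i j ij /=; rewrite ltrN2 lB.
  - exact: rB.
  - by have [/andP[? ?] ?] := Bp i; rewrite lerN2.
  by exists D; split=> //; split; rewrite // rD -lerN2 lD.
case: C.
- (* Right ends and heights increase, hence the reversal of the index. *)
  have [c cP] := dominance_colouring (@rcoord R) (@height R)
    (fun B => - lcoord B) k_gt0 finF.
  exists c => B p FB [_ _ [/= rB tB]] Bp a.
  have rev_lt (i j : 'I_k) : (i < j)%N -> (rev_ord j < rev_ord i)%N.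
    by move=> ij; apply: ltn_sub2l => //; apply: leq_ltn_trans ij (ltn_ord j).
  have [||i|D [FD cD [rD hD lD]]] :=
    cP (B \o @rev_ord k) p.1 p.2 (- p.1) (fun=> FB _) _ _ _ a.
  - by move=> i j /rev_lt; apply: rB.
  - by move=> i j /rev_lt; apply: tB.
  - by have [/andP[? ?] ?] := Bp (rev_ord i); rewrite lerN2.
  by exists D; split=> //; split; rewrite // rD -lerN2 lD.
- have [c cP] := dominance_colouring (fun B => - lcoord B) (@height R)
    (@rcoord R) k_gt0 finF.
  exists c => B p FB [_ lB [/= rB tB]] Bp a.
  have [||i|D [FD cD [lD hD rD]]] := cP B (- p.1) p.2 p.1 FB _ _ _ a.
  - by move=> i j ij /=; rewrite ltrN2 lB.
  - exact: tB.
  - by have [/andP[? ?] ?] := Bp i; rewrite lerN2.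
  by exists D; split=> //; split; rewrite // rD -lerN2 lD.
- have [c cP] := nested_intervals.
  by exists c => B p FB [_ lB [rB _]]; apply: cP.
- have [c cP] := nested_intervals.
  by exists c => B p FB [_ lB [rB _]]; apply: cP.
Qed.

(** * Lower bound: a single configuration with too few members *)

(** The offset [2 n] keeps every right end at or beyond the abscissa [n], which
    no left end exceeds, also when the right ends decrease. *)
Definition model_rect (R : realType) (C : config_type) (n : nat) (i : 'I_n) :
    brect R :=
  let x : R := i%:R in
  let w : R := n.*2%:R in
  match C with
  | IncreasingSteps => BRect x (w + x) x
  | DecreasingSteps => BRect x (w + x) (- x)
  | Tower => BRect x (w - x) x
  | Nested => BRect x (w - x) (- x)
  end.

Lemma model_rect_common_point (R : realType) (C : config_type) (n : nat) :
  covered_by_all (@model_rect R C n) (n%:R, - n%:R).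
Proof.
move=> i; have i_ge0 : 0 <= i%:R :> R by rewrite ler0n.
have i_le : i%:R <= n%:R :> R by rewrite ler_nat ltnW.
rewrite /model_rect /brect_set -addnn natrD /=.
have n_ge0 : 0 <= n%:R :> R by rewrite ler0n.
have hi : n%:R <= n%:R + n%:R + i%:R :> R by rewrite -addrA lerDl addr_ge0.
have lo : n%:R <= n%:R + n%:R - i%:R :> R by rewrite -addrA lerDl subr_ge0.
have Nn : - n%:R <= i%:R :> R by apply: le_trans i_ge0; rewrite oppr_le0.
by case: C; rewrite /= i_le ?hi ?lo ?lerN2 ?Nn.
Qed.

Lemma model_rect_configuration (R : realType) (C : config_type) (n : nat) :
  configuration C (@model_rect R C n).
Proof.
split; first by exists (n%:R, - n%:R); apply: model_rect_common_point.
  by move=> i j ij; case: C; rewrite /= ltr_nat.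
by case: C; split=> i j ij; rewrite /= ?ltrD2l ?ltrN2 ltr_nat.
Qed.

(** For [n = 0] the family is empty, every point is covered by the empty
    configuration, and the counting argument below still forces [k <= 0]. *)
Lemma always_colourable_geq (R : realType) (C : config_type) (k n : nat) :
  always_colourable R C k n -> (k <= n)%N.
Proof.
move=> /(_ (range (@model_rect R C n)) (finite_image _ finite_finset)).
case=> c cP.
have seen_all a : exists i, c (@model_rect R C n i) = a.
  have [|B [[i _ <-] ci _]] := cP _ _ _ (model_rect_configuration R C n)
    (@model_rect_common_point R C n) a; first by move=> i; exists i.
  by exists i.
have [f fP] := fin_all_exists seen_all.
have f_inj : injective f by move=> a b fab; rewrite -(fP a) fab fP.
by have := leq_card f f_inj; rewrite !card_ord.
Qed.

Theorem theorem2p1 (R : realType) (k : nat) (C : config_type) (hk : (0 < k)%N) :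
  is_mstar R C k k.
Proof.
split; first exact: always_colourable_self.
by move=> n; apply: always_colourable_geq.
Qed.
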